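(* Let $\widehat a(z)=\widehat a_n\prod_{j=0}^{m}(z-z_j)^{k_j}$ be a polynomial of degree $n$ with real coefficients and leading coefficient $\widehat a_n\ne0$, where $z_0,\dots,z_m\in\mathbb C$ satisfy $z_i\ne z_j$ for $i\ne j$, the multiplicities $k_j\ge1$ satisfy $k_0+\dots+k_m=n$, and $\widehat a(z)$ and $\widehat a(-z)$ are relatively prime. Let $\star\in\{+,-\}$, $1\le t\le n$, $\ell^+=2$, $\ell^-=1$. Then the unique polynomial solution $p_t^\star(z)$ of degree less than $n$ of $$\widehat a(z)\,p_t^\star(z)\ \star\ \widehat a(-z)\,p_t^\star(-z)=2\,z^{2t-\ell^\star}$$ satisfies $$p_t^\star(z)=(-1)^{\ell^\star}\,\widehat a_n^{-1}\prod_{j=0}^{m}(z+z_j)^{k_j}\ \sum_{i=0}^{m}\sum_{s=1}^{k_i}\frac{(-1)^s\,c_{i,k_i-s}}{(z+z_i)^s},$$ where $$c_{i,j}=\frac1{j!}\left(\frac{d^j}{dz^j}\,\frac{2z^{2t-\ell^\star}}{\omega_i(z)}\right)\bigg|_{z=z_i},\qquad 0\le j\le k_i-1,\ 0\le i\le m,$$ $\omega(z)$ is the monic polynomial associated with $\widehat a(z)\widehat a(-z)$, and $\omega_i(z)=\dfrac{\omega(z)}{(z-z_i)^{k_i}}$.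
   Context: For $\star\in\{+,-\}$, the expression $A\star B$ means $A+B$ if $\star=+$ and $A-B$ if $\star=-$. The monic polynomial associated with $\widehat a(z)\widehat a(-z)$ is $\omega(z)=\prod_{j=0}^m(z-z_j)^{k_j}\prod_{j=0}^m(z+z_j)^{k_j}=(-1)^n\widehat a_n^{-2}\,\widehat a(z)\widehat a(-z)$. *)

(* Defs.v *)
From mathcomp Require Export all_boot all_order all_algebra.
From mathcomp Require Export complex.
From mathcomp Require Export reals topology normedtype derive.
Export Order.TTheory GRing.Theory Num.Theory.
Export numFieldNormedType.Exports.

Set Implicit Arguments.
Unset Strict Implicit.
Unset Printing Implicit Defensive.

Local Open Scope ring_scope.

Variant pm := Plus | Minus.

Definition star (V : zmodType) (s : pm) (A B : V) : V :=
  match s with Plus => A + B | Minus => A - B end.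

Definition ell (s : pm) : nat :=
  match s with Plus => 2%N | Minus => 1%N end.

(* q(-z) as a polynomial in z *)
Definition reflect_poly (A : nzRingType) (q : {poly A}) : {poly A} := q \Po - 'X.

Definition pm_solution (C : fieldType) (s : pm) (a : {poly C}) (n t : nat)
    (p : {poly C}) : Prop :=
  (size p <= n)%N (* i.e. deg p < n *) /\
  star s (a * p) (reflect_poly a * reflect_poly p) = 2 *: 'X^(2 * t - ell s).

Definition omega (C : fieldType) (m : nat) (z : 'I_m.+1 -> C)
    (k : 'I_m.+1 -> nat) : {poly C} :=
  \prod_(j < m.+1) ('X - (z j)%:P) ^+ k j *
  \prod_(j < m.+1) ('X + (z j)%:P) ^+ k j.

(* The division is exact and is carried out on polynomials: a pointwise quotient
   of values would be 0 / 0 = 0 at z i, the very point where omega_at z k i is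
   to be evaluated. *)
Definition omega_at (C : fieldType) (m : nat) (z : 'I_m.+1 -> C)
    (k : 'I_m.+1 -> nat) (i : 'I_m.+1) : {poly C} :=
  omega z k %/ ('X - (z i)%:P) ^+ k i.

(* derive1n is the j-th iterate of the derivative of a function of one variable
   in C, hence the complex derivative when C is the field of complex numbers. *)
Definition pf_coef (C : numFieldType) (s : pm) (t m : nat) (z : 'I_m.+1 -> C)
    (k : 'I_m.+1 -> nat) (i : 'I_m.+1) (j : nat) : C :=
  (j`!%:R)^-1 *
  derive1n j
    (fun w : C => 2 * w ^+ (2 * t - ell s) / (omega_at z k i).[w] : C) (z i).

(* Main.v *)
Require Import Defs.
From mathcomp Require Import boolp functions.
From mathcomp Require Import ring zify.

(** Write F = 2 z^(2t - l), where l is the exponent attached to the sign, and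
e = (-1)^l, so that the equation reads a(z) p(z) + e a(-z) p(-z) = F(z) and
F(-z) = e F(z).

The equation is equivalent to a congruence.  Put U(z) = e p(-z).  A solution
satisfies a(-z) U(z) = F(z) modulo a(z), and since a(z) and a(-z) are coprime
there is at most one such U of degree less than n.  Conversely, if U satisfies
this congruence and p(z) = e U(-z), the defect a(z) p(z) + e a(-z) p(-z) - F(z)
is divisible by a(z); reflection multiplies it by e, so it is also divisible by
a(-z), hence by a(z) a(-z), which has degree 2n, and it vanishes because its own
degree is less than 2n.  This is [pm_solutionP]; existence, uniqueness and the
value of p all reduce to exhibiting one U.

Up to the constant (-1)^n an^(-1), the polynomial U is the numerator over
prod_j (z - z_j)^(k_j) of the part of the partial fraction decomposition of
F / omega that is carried by the z_i.  This numerator is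
sum_i T_i B_i, where B_i = prod_(j <> i) (z - z_j)^(k_j) and T_i is a polynomial of degree less than
k_i with T_i omega_i = F modulo (z - z_i)^(k_i); [partial_fractions_dvdp] checks
the congruence.

Such a T_i exists by the Bezout identity.  Its coefficients on the powers of
z - z_i are the c_(i,j): the quotient rule preserves the shape of the
congruence, at the cost of one power of z - z_i, so the derivatives of
F / omega_i and of T_i agree at z_i up to order k_i - 1 ([derive1n_ratio]).
Evaluating the formula for U at -w gives the one for p(w). *)

Local Open Scope ring_scope.
Local Open Scope complex_scope.

Set Implicit Arguments.
Unset Strict Implicit.
Unset Printing Implicit Defensive.

(** * Derivatives of rational functions *)

Section Derivatives.
Variable C : numFieldType.
Implicit Types (N D T p : {poly C}) (f : C -> C) (x z w : C).

Lemma is_derive1_horner p x : is_derive x (1 : C) (horner p) p^`().[x].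
Proof.
elim/poly_ind: p => [|p c IHp].
  have -> : horner 0 = cst 0 :> (C -> C) by apply/funext => w; rewrite horner0.
  by rewrite deriv0 horner0; exact: is_derive_cst.
have -> : horner (p * 'X + c%:P) = horner p * id + cst c :> (C -> C).
  by apply/funext => w; rewrite !hornerE.
apply: is_derive_eq.
by rewrite derivMXaddC !hornerE /= /GRing.scale /= mulr1 [x * _]mulrC.
Qed.

Lemma horner_neq0_near D x : D.[x] != 0 -> \forall y \near x, D.[y] != 0.
Proof.
move=> Dx; have [dD _] := is_derive1_horner D x.
have /differentiable_continuous Dc : differentiable (horner D) x.
  exact/derivable1_diffP.
apply: (Dc (fun y : C => y != 0)).
exists `|D.[x]|; first by rewrite /= normr_gt0.
by move=> y /=; apply: contraTneq => ->; rewrite subr0 ltxx.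
Qed.

Lemma derive1_ratio f N D x :
    (forall w, D.[w] != 0 -> f w = N.[w] / D.[w]) -> D.[x] != 0 ->
  derive1 f x = (N^`() * D - N * D^`()).[x] / (D ^+ 2).[x].
Proof.
move=> fE Dx; rewrite derive1E.
have [dN DN] := is_derive1_horner N x; have [dD DD] := is_derive1_horner D x.
have -> : 'D_1 f x = 'D_1 (horner N * (fun w => D.[w]^-1)) x.
  apply: near_eq_derive.
  have := horner_neq0_near Dx; apply: filterS => w Dw.
  by rewrite fE.
rewrite deriveM //; last exact: derivableV.
rewrite deriveV // DN DD !hornerE.
transitivity (N.[x] * (- D.[x] ^- 2 * D^`().[x]) + D.[x]^-1 * N^`().[x]) => //.
by field.
Qed.

(** A congruence N = T * D modulo ('X - z)^k, stated without division, forces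
the derivatives of N / D and of T of order less than k to agree at z.  Writing
it for numerator and denominator makes the induction go through: the derivative
of N / D is again a ratio, with denominator D^2, and it is congruent to T^`()
modulo ('X - z)^(k - 1). *)
Lemma derive1n_ratio j k f N D T z :
    (forall w, D.[w] != 0 -> f w = N.[w] / D.[w]) -> D.[z] != 0 ->
    ('X - z%:P) ^+ k %| N - T * D -> (j < k)%N ->
  derive1n j f z = T^`(j).[z].
Proof.
elim: j k f N D T => [|j IHj] [|k] f N D T fE Dz //.
  move=> /dvdpP[E NE] _; rewrite derivn0 derive1n0 fE //.
  apply: (mulIf Dz); rewrite divfK //.
  move/(congr1 (horner^~ z)): NE; rewrite !hornerE subrr exprS mul0r mulr0.
  by move/eqP; rewrite subr_eq0 => /eqP.
move=> /dvdpP[E /eqP]; rewrite subr_eq => /eqP NE ltjk.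
rewrite /derive1n iterSr derivSn.
apply: (IHj k _ (N^`() * D - N * D^`()) (D ^+ 2)) => //.
- move=> w; rewrite horner_exp expf_eq0 /= => Dw; rewrite -horner_exp.
  exact: derive1_ratio.
- by rewrite horner_exp expf_neq0.
rewrite NE; apply/dvdpP.
(* With N = M + T D and M = E ('X - z)^(k+1), the terms in T cancel out of
   N' D - N D' - T' D^2, which is M' D - M D'. *)
exists (E^`() * ('X - z%:P) * D + E * D *+ k.+1 - E * ('X - z%:P) * D^`()).
rewrite derivD !derivM deriv_exp derivXsubC exprS /=; ring.
Qed.

(** A polynomial T of degree less than k that is congruent to N / D modulo
('X - z)^k is the Taylor polynomial of N / D at z. *)
Lemma horner_taylor_ratio k N D T z w :
    D.[z] != 0 -> (size T <= k)%N -> ('X - z%:P) ^+ k %| N - T * D ->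
  T.[w] = \sum_(j < k) (j`!%:R)^-1 *
    derive1n j (fun y => N.[y] / D.[y]) z * (w - z) ^+ j.
Proof.
move=> Dz szT NT; rewrite -[in LHS](subrK z w) addrC.
rewrite (nderiv_taylor_wide _ szT); last exact: mulrC.
apply: eq_bigr => j _; congr (_ * _).
rewrite (derive1n_ratio _ Dz NT) // nderivn_def hornerMn.
rewrite -[_.[z] *+ _]mulr_natl mulKf //.
by rewrite pnatr_eq0 -lt0n fact_gt0.
Qed.

End Derivatives.

(** * Reflection and the equation for p *)

Section Reflection.
Variable C : fieldType.
Implicit Types (p q a U : {poly C}) (s : pm).

Lemma reflectD p q : reflect_poly (p + q) = reflect_poly p + reflect_poly q.
Proof. exact: comp_polyD. Qed.

Lemma reflectB p q : reflect_poly (p - q) = reflect_poly p - reflect_poly q.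
Proof. exact: comp_polyB. Qed.

Lemma reflectM p q : reflect_poly (p * q) = reflect_poly p * reflect_poly q.
Proof. exact: comp_polyM. Qed.

Lemma reflectZ c p : reflect_poly (c *: p) = c *: reflect_poly p.
Proof. exact: comp_polyZ. Qed.

Lemma horner_reflect p w : (reflect_poly p).[w] = p.[- w].
Proof. by rewrite horner_comp hornerN hornerX. Qed.

Lemma reflectK : involutive (@reflect_poly C).
Proof.
move=> p; rewrite /reflect_poly -comp_polyA.
by rewrite linearN /= comp_polyX opprK comp_polyXr.
Qed.

Lemma size_reflect p : size (reflect_poly p) = size p.
Proof. by rewrite size_comp_poly2 // size_polyN size_polyX. Qed.

Lemma reflect_dvdp p q : (reflect_poly p %| reflect_poly q) = (p %| q).
Proof.
apply/idP/idP=> /(dvdp_comp_poly (- 'X)) //.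
by rewrite -![_ \Po _]/(reflect_poly _) !reflectK.
Qed.

Lemma reflect1 : reflect_poly (1 : {poly C}) = 1.
Proof. exact: comp_polyC. Qed.

Lemma reflect_exp p d : reflect_poly (p ^+ d) = reflect_poly p ^+ d.
Proof. by elim: d => [|d IHd]; rewrite ?reflect1 // !exprS reflectM IHd. Qed.

Lemma reflect_Xn d : reflect_poly 'X^d = (-1) ^+ d *: 'X^d :> {poly C}.
Proof.
rewrite reflect_exp /reflect_poly comp_polyX [(- 'X) ^+ d]exprNn.
by rewrite -mul_polyC polyC_exp polyCN.
Qed.

Lemma starE s p q : star s p q = p + (-1) ^+ ell s *: q.
Proof. by case: s; rewrite /= ?sqrrN ?expr1n ?expr1 ?scale1r ?scaleN1r. Qed.

(** The two-sided equation is the congruence a(-z) U = F modulo a(z) in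
disguise: reflection multiplies the equation by (-1)^l, so that divisibility of
the defect by a(z) entails divisibility by a(-z), and a size count does the
rest. *)
Lemma pm_solutionP s a U n t p :
    size a = n.+1 -> coprimep a (reflect_poly a) -> (1 <= t <= n)%N ->
    (size U <= n)%N ->
    a %| reflect_poly a * U - 2 *: 'X^(2 * t - ell s) ->
  pm_solution s a n t p <-> p = (-1) ^+ ell s *: reflect_poly U.
Proof.
move=> sza co_a /andP[t_gt0 le_tn] szU dvdU.
set F := 2 *: _ in dvdU *; set e : C := (-1) ^+ ell s.
have ee : e * e = 1 by rewrite -expr2 sqrr_sign.
have eK q : e *: (e *: q) = q by rewrite scalerA ee scale1r.
have e_neq0 : e != 0 by rewrite signr_eq0.
have reflF : reflect_poly F = e *: F.
  rewrite reflectZ reflect_Xn !scalerA mulrC; congr (_ * _ *: _).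
  rewrite -signr_odd oddB; last by case: (s) => /=; lia.
  by rewrite mul2n odd_double /= signr_odd.
have lead_small q : a %| q -> (size q <= n)%N -> q = 0.
  move=> dvdq szq; apply/eqP; apply: contraLR szq => q0.
  by rewrite -ltnNge -sza dvdp_leq.
rewrite /pm_solution starE -/e -/F; split=> [[szp pE] | ->].
  have : a %| reflect_poly a * (U - e *: reflect_poly p).
    rewrite [X in a %| X](_ : _ = (reflect_poly a * U - F) + a * p).
      by rewrite dvdp_add // dvdp_mulr.
    by rewrite -pE mulrBr -scalerAr; ring.
  rewrite Gauss_dvdpr // => /lead_small U_p.
  have /eqP : U - e *: reflect_poly p = 0.
    apply: U_p; rewrite (leq_trans (size_polyD _ _)) // geq_max szU.
    by rewrite size_polyN size_scale // size_reflect.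
  by rewrite subr_eq0 => /eqP ->; rewrite reflectZ reflectK eK.
split; first by rewrite size_scale // size_reflect.
rewrite reflectZ reflectK -!scalerAr eK.
apply/eqP; rewrite -subr_eq0; set D := _ - F.
have dvd_aD : a %| D.
  by rewrite /D -addrA dvdp_add // dvdpZr // dvdp_mulr.
have reflD : reflect_poly D = e *: D.
  rewrite /D reflectB reflectD reflectZ !reflectM !reflectK reflF.
  rewrite scalerBr scalerDr eK [_ + e *: _]addrC.
  by congr (_ + _ - _); rewrite mulrC.
have dvd_raD : reflect_poly a %| D.
  by rewrite -(dvdpZr _ _ e_neq0) -reflD reflect_dvdp.
have : a * reflect_poly a %| D by rewrite Gauss_dvdp // dvd_aD.
apply: contraLR => D0; apply/negP => /(dvdp_leq D0).
apply/negP; rewrite -ltnNge.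
have a0 : a != 0 by rewrite -size_poly_gt0 sza.
rewrite size_mul // -?size_poly_gt0 size_reflect sza // addnS addSn /= ltnS.
have szM (q r : {poly C}) :
    (size q <= n.+1 -> size r <= n -> size (q * r)%R <= n + n)%N.
  by move=> szq szr; rewrite (leq_trans (size_polyMleq _ _)) //; lia.
rewrite (leq_trans (size_polyD _ _)) // geq_max size_polyN.
apply/andP; split; last first.
  rewrite (leq_trans (size_scale_leq _ _)) // size_polyXn.
  by case: (s) => /=; lia.
rewrite (leq_trans (size_polyD _ _)) // geq_max size_scale //.
by rewrite !szM ?size_reflect ?sza.
Qed.

End Reflection.

(** * Partial fractions *)

Section PartialFractions.
Variable C : fieldType.
Implicit Types (N D L Q : {poly C}).

Lemma coprimep_quotient L N D :
    coprimep L D -> L != 0 ->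
  exists2 T : {poly C}, (size T < size L)%N & L %| N - T * D.
Proof.
move=> /Bezout_eq1_coprimepP[[u v] /= uv1] L0.
exists ((N * v) %% L); first by rewrite ltn_modp.
apply/dvdpP; exists (N * u + (N * v) %/ L * D).
rewrite -{1}[N]mulr1 -{1}uv1 mulrDr [v * D in LHS]mulrC.
have -> : N * (u * L) + N * (D * v) = N * u * L + N * v * D by ring.
by rewrite {1}(divp_eq (N * v) L); ring.
Qed.

Lemma coprimep_prodr (I : Type) (r : seq I) (A : pred I)
    (L : I -> {poly C}) (p : {poly C}) :
  (forall i, A i -> coprimep p (L i)) -> coprimep p (\prod_(i <- r | A i) L i).
Proof.
move=> co_p; elim/big_rec: _ => [|i q Ai coq]; first exact: coprimep1.
by rewrite coprimepMr co_p.
Qed.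

Lemma prod_coprime_dvdp (I : eqType) (r : seq I) (L : I -> {poly C})
    (p : {poly C}) :
    uniq r -> {in r &, forall i j, i != j -> coprimep (L i) (L j)} ->
  {in r, forall i, L i %| p} -> \prod_(i <- r) L i %| p.
Proof.
elim: r => [|i r IHr] /=; first by rewrite big_nil dvd1p.
case/andP=> ir uniq_r co_L dvdL; rewrite big_cons Gauss_dvdp.
  rewrite dvdL ?mem_head // IHr // => [j l jr lr|j jr].
    by apply: co_L; rewrite inE ?jr ?lr orbT.
  by apply: dvdL; rewrite inE jr orbT.
rewrite big_seq; apply: coprimep_prodr => j jr; apply: co_L.
- exact: mem_head.
- by rewrite inE jr orbT.
- by apply: contraNneq ir => ->.
Qed.

(** The Chinese remainder form of a partial fraction decomposition: modulo L i
only the i-th summand survives, because all the other products contain the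
factor L i. *)
Lemma partial_fractions_dvdp (I : finType) (L T : I -> {poly C}) Q N :
    (forall i j, i != j -> coprimep (L i) (L j)) ->
    (forall i, L i %| N - T i * (\prod_(j | j != i) L j * Q)) ->
  \prod_i L i %| Q * (\sum_i T i * \prod_(j | j != i) L j) - N.
Proof.
move=> co_L dvdL; apply: prod_coprime_dvdp => [|i j _ _|i _].
- exact: index_enum_uniq.
- exact: co_L.
rewrite (bigD1 i) //= mulrDr addrAC.
rewrite dvdp_add //.
  by rewrite -dvdpNr opprB mulrCA [Q * _]mulrC; exact: dvdL.
rewrite dvdp_mull //; apply: (big_ind (fun p => L i %| p)) => [|p q|j ji].
- exact: dvdp0.
- exact: dvdp_add.
by rewrite dvdp_mull // (bigD1 i) 1?eq_sym //= dvdp_mulr.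
Qed.

Lemma size_prod_expXsubC (I : finType) (A : pred I)
    (z : I -> C) (k : I -> nat) :
  size (\prod_(j | A j) ('X - (z j)%:P) ^+ k j) = (\sum_(j | A j) k j).+1.
Proof.
rewrite size_prod => [|j _]; last by rewrite expf_neq0 // polyXsubC_eq0.
rewrite (eq_bigr (fun j => k j + 1)%N) => [|j _].
  by rewrite big_split /= sum1_card -addSn addnK.
by rewrite size_exp_XsubC addn1.
Qed.

Lemma reflect_prod_expXsubC (I : finType) (z : I -> C) (k : I -> nat) :
  reflect_poly (\prod_j ('X - (z j)%:P) ^+ k j) =
  (-1) ^+ (\sum_j k j) *: \prod_j ('X + (z j)%:P) ^+ k j.
Proof.
rewrite (big_morph _ (@reflectM C) (reflect1 C)).
rewrite -mul_polyC polyC_exp polyCN -prodrXr -big_split /=.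
apply: eq_bigr => j _.
rewrite reflect_exp reflectB /reflect_poly comp_polyX comp_polyC.
by rewrite -opprD exprNn.
Qed.

(** Division by the full power turns a Taylor polynomial in - y into the
principal part, indexed by the order r of the pole instead of the exponent
k - r. *)
Lemma sum_truncated_div (c : nat -> C) (k : nat) (y : C) : y != 0 ->
  (\sum_(j < k) c j * (- y) ^+ j) / (- y) ^+ k =
  \sum_(1 <= r < k.+1) (-1) ^+ r * c (k - r)%N / y ^+ r.
Proof.
move=> y0; rewrite mulr_suml big_add1 /= big_nat_rev /= big_mkord.
apply: eq_bigr => j _; rewrite add0n subnSK // subKn; last exact: ltnW.
have -> : (- y) ^+ k = (- y) ^+ (k - j) * (- y) ^+ j.
  by rewrite -exprD subnK // ltnW.
rewrite invfM [_^-1 * _^-1]mulrC mulrA mulfK; last first.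
  by rewrite expf_neq0 // oppr_eq0.
rewrite [(- y) ^+ _]exprNn invfM.
by rewrite -exprVn invrN1 mulrCA mulrA.
Qed.

End PartialFractions.

(** * The explicit solution *)

Theorem proposition3 (R : realType) (n m t : nat) (s : pm)
    (a : {poly R}) (an : R) (z : 'I_m.+1 -> R[i]) (k : 'I_m.+1 -> nat)
    (aC := map_poly (real_complex R) a : {poly R[i]}) :
  an != 0 ->
  aC = an%:C *: \prod_(j < m.+1) ('X - (z j)%:P) ^+ k j ->
  (forall i j : 'I_m.+1, i <> j -> z i <> z j) ->
  (forall j : 'I_m.+1, (1 <= k j)%N) ->
  (\sum_(j < m.+1) k j)%N = n ->
  coprimep a (reflect_poly a) ->
  (1 <= t <= n)%N ->
  (exists! p : {poly R[i]}, pm_solution s aC n t p) /\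
  (forall p : {poly R[i]}, pm_solution s aC n t p ->
    forall w : R[i], (forall j : 'I_m.+1, w + z j != 0) ->
      p.[w] = (-1) ^+ ell s * (an%:C)^-1 *
              \prod_(j < m.+1) (w + z j) ^+ k j *
              \sum_(i < m.+1) \sum_(1 <= r < (k i).+1)
                 (-1) ^+ r * pf_coef s t z k i (k i - r) / (w + z i) ^+ r).
Proof.
move=> an0 aE z_inj k_gt0 kn co_a tn.
pose L j := ('X - (z j)%:P) ^+ k j : {poly R[i]}.
pose B i := \prod_(j | j != i) L j.
pose Q := \prod_j ('X + (z j)%:P) ^+ k j : {poly R[i]}.
pose F := 2 *: 'X^(2 * t - ell s) : {poly R[i]}.
have anC0 : an%:C != 0 :> R[i] by rewrite fmorph_eq0.
have an_sign0 : an%:C * (-1) ^+ n != 0 :> R[i].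
  by rewrite mulf_neq0 // signr_eq0.
have raE : reflect_poly aC = (an%:C * (-1) ^+ n) *: Q.
  by rewrite aE reflectZ reflect_prod_expXsubC scalerA kn.
have co_aC : coprimep aC (reflect_poly aC).
  have -> : reflect_poly aC = map_poly (real_complex R) (reflect_poly a).
    rewrite /reflect_poly map_comp_poly.
 by rewrite rmorphN /= map_polyX.
  by rewrite coprimep_map.
have size_aC : size aC = n.+1.
  by rewrite aE size_scale // size_prod_expXsubC kn.
have L_neq0 i : L i != 0 by rewrite expf_neq0 // polyXsubC_eq0.
have L_dvd_aC i : L i %| aC.
  by rewrite aE dvdpZr // (bigD1 i) //= dvdp_mulr.
have co_L i j : i != j -> coprimep (L i) (L j).
  move=> /eqP ij; apply/coprimep_expl/coprimep_expr/coprimep_XsubC2.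
  by rewrite subr_eq0; apply/eqP => /esym; exact: z_inj.
have co_omega i : coprimep (L i) (B i * Q).
  rewrite coprimepMr; apply/andP; split.
    by apply: coprimep_prodr => j ji; rewrite co_L // eq_sym.
  rewrite -(coprimepZr _ _ an_sign0) -raE.
  exact: coprimep_dvdr (L_dvd_aC i) co_aC.
have omegaE i : omega_at z k i = B i * Q.
  rewrite /omega_at /omega (bigD1 i) //= -mulrA mulKp //; exact: L_neq0.
have [T szT dvdT] : exists2 T : 'I_m.+1 -> {poly R[i]},
    (forall i, (size (T i) <= k i)%N) & (forall i, L i %| F - T i * (B i * Q)).
  have Tex i : exists T : {poly R[i]},
      (size T <= k i)%N /\ L i %| F - T * (B i * Q).
    have [T szT dvdT] := coprimep_quotient F (co_omega i) (L_neq0 i).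
    by exists T; split; rewrite // -ltnS -(size_exp_XsubC (k i) (z i)).
  by exists (fun i => projT1 (cid (Tex i))) => i; case: (projT2 (cid (Tex i))).
(* The scalar cancels the one in a(-z) = an (-1)^n Q. *)
pose U := (an%:C * (-1) ^+ n)^-1 *: \sum_i T i * B i.
have szU : (size U <= n)%N.
  rewrite (leq_trans (size_scale_leq _ _)) // (leq_trans (size_sum _ _ _)) //.
  apply/bigmax_leqP => i _; rewrite (leq_trans (size_polyMleq _ _)) //.
  rewrite size_prod_expXsubC addnS /= -kn [X in (_ <= X)%N](bigD1 i) //=.
  by rewrite leq_add2r.
have dvdU : aC %| reflect_poly aC * U - F.
  rewrite raE -scalerAl -scalerAr scalerA divff // scale1r aE dvdpZl //.
  exact: partial_fractions_dvdp.
have solE p := pm_solutionP p size_aC co_aC tn szU dvdU.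
split.
  exists ((-1) ^+ ell s *: reflect_poly U); split; first exact/solE.
  by move=> p /solE ->.
move=> p /solE -> w w_z; rewrite hornerZ horner_reflect hornerZ.
have D_neq0 i : (omega_at z k i).[z i] != 0.
  move: (co_omega i); rewrite omegaE coprimep_sym coprimep_pexpr //.
  by rewrite coprimep_XsubC.
(* T_i(-w) is expanded in powers of -w - z_i, which is the opposite of w + z_i. *)
have T_div i : (T i).[- w] / (- (w + z i)) ^+ k i =
    \sum_(1 <= r < (k i).+1)
       (-1) ^+ r * pf_coef s t z k i (k i - r) / (w + z i) ^+ r.
  rewrite -(sum_truncated_div (pf_coef s t z k i)) //; congr (_ / _).
  have dvdTi : ('X - (z i)%:P) ^+ k i %| F - T i * omega_at z k i.
    by rewrite omegaE; exact: dvdT.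
  rewrite (horner_taylor_ratio _ (D_neq0 i) (szT i) dvdTi).
  have -> : (fun y => F.[y] / (omega_at z k i).[y]) =
      (fun y => 2 * y ^+ (2 * t - ell s) / (omega_at z k i).[y]).
    by apply/funext => y; rewrite hornerZ hornerXn.
  by apply: eq_bigr => j _; rewrite opprD.
have B_div i : (B i).[- w] =
    (-1) ^+ n * (\prod_j (w + z j) ^+ k j) / (- (w + z i)) ^+ k i.
  apply: (canRL (mulfK _)); first by rewrite expf_neq0 // oppr_eq0.
  have -> : (- (w + z i)) ^+ k i = (L i).[- w].
    by rewrite horner_exp !hornerE opprD.
  rewrite -hornerM mulrC -(bigD1 i (P := xpredT)) //= -horner_reflect.
  rewrite reflect_prod_expXsubC kn hornerZ horner_prod; congr (_ * _).
  by apply: eq_bigr => j _; rewrite horner_exp !hornerE.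
rewrite -!mulrA; congr (_ * _); rewrite horner_sum !mulr_sumr.
apply: eq_bigr => i _; rewrite -T_div hornerM B_div invfM.
have nn : (-1) ^- n * (-1) ^+ n = 1 :> R[i] by rewrite mulVf // signr_eq0.
set P := \prod_j _; set y := _ ^+ k i.
have -> : (an%:C)^-1 / (-1) ^+ n * ((T i).[- w] * ((-1) ^+ n * P / y)) =
  (an%:C)^-1 * ((-1) ^- n * (-1) ^+ n) * P * ((T i).[- w] / y) by ring.
by rewrite nn mulr1 mulrA.
Qed.
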